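(* Let $h_w(x)=\langle w,x\rangle$ with $w\in\mathbb R^d$, assume $\|x\|\le M$ for all $x\in X\subset\mathbb R^d$, and let $L(z,y)=|z-y|$. Let $D$ be a distribution on $X\times\mathbb R$ such that $|y|\le Y_{\max}$ almost surely. Let $P=\mathcal N(0,\sigma^2I_d)$ with $\sigma>0$, and let $\delta\in(0,1]$. Then, with probability at least $1-\delta$ over $S\sim D^n$, for all probability distributions $Q$ on $\mathbb R^d$, $$\mathbb E_{w\sim Q}L_D(h_w)\le\mathbb E_{w\sim Q}L_S(h_w)+\frac{M\sigma\sqrt{d+1}}{\sqrt n}\left[D_{\mathrm{KL}}(Q\|P)+\ln\frac2\delta+\frac12\right]+Y_{\max}\sqrt{\frac{\ln(2/\delta)}{2n}}.$$
   Context: $L_D(h):=\mathbb E_{(x,y)\sim D}[L(h(x),y)]$ and, for $S=\{(x_i,y_i)\}_{i=1}^n$, $L_S(h):=\frac1n\sum_{i=1}^nL(h(x_i),y_i)$. $D_{\mathrm{KL}}$ is the Kullback–Leibler divergence. *)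

(* Defs.v *)
From HB Require Import structures.
From mathcomp Require Import all_boot all_order all_algebra.
From mathcomp Require Import all_classical all_reals all_analysis.

Set Implicit Arguments.
Unset Strict Implicit.
Unset Printing Implicit Defensive.

Import Order.TTheory GRing.Theory Num.Theory.
Import numFieldNormedType.Exports.
Local Open Scope classical_set_scope.
Local Open Scope ring_scope.

(* R^d as tuples: the library puts on them the sigma-algebra generated by the
   coordinates, i.e. the Borel sets of R^d.  (Row vectors 'rV[R]_d carry no
   measurable structure, and their library norm is the sup norm.) *)
Notation euclid R d := (d.-tuple (measurableTypeR R)).

Section Euclidean.
Context {R : realType} {d : nat}.
Implicit Types w x : euclid R d.

Definition dotp w x : R := \sum_(i < d) tnth w i * tnth x i.

Definition enorm x : R := Num.sqrt (dotp x x).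

Definition linear_predictor w : euclid R d -> R := dotp w.

End Euclidean.

Definition absolute_loss {R : realType} (z y : R) : R := `|z - y|.

Section ProductPower.
Context {dT : measure_display} {T : measurableType dT} {R : realType}.

Definition tuple_cons n (p : T * n.-tuple T) : n.+1.-tuple T :=
  [tuple of p.1 :: p.2].

Lemma measurable_tuple_cons n : measurable_fun setT (@tuple_cons n).
Proof. exact: measurable_cons. Qed.

HB.instance Definition _ n :=
  isMeasurableFun.Build _ _ _ _ (@tuple_cons n) (@measurable_tuple_cons n).

(* The n-fold product measure P^n on n-tuples. *)
Fixpoint prob_power (P : probability T R) (n : nat) :
    probability (n.-tuple T) R :=
  match n with
  | 0 => dirac [tuple]
  | m.+1 => distribution (P \x prob_power P m)%E (@tuple_cons m)
  end.

Lemma prob_power_box (P : probability T R) n (A : 'I_n -> set T) :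
  (forall i, measurable (A i)) ->
  prob_power P n [set s | forall i, A i (tnth s i)] = (\prod_(i < n) P (A i))%E.
Proof.
elim: n A => [|n IH] A mA /=.
  by rewrite big_ord0 [X in dirac _ X](_ : _ = setT) ?diracT// -subTset => s _ [].
rewrite big_ord_recl /= -IH// /distribution /pushforward.
pose B := [set s : n.-tuple T | forall i, A (lift ord0 i) (tnth s i)].
have mB : measurable B.
  rewrite [B](_ : _ = \bigcap_(i in [set: 'I_n])
      ((fun s => tnth s i) @^-1` A (lift ord0 i))).
    apply: fin_bigcap_measurable => [|i _]; first exact: finite_finset.
    by rewrite -[X in measurable X]setTI; exact: measurable_tnth.
  by apply/seteqP; split => s /= h i; [move=> _|]; exact: h.
rewrite -[RHS](product_measure1E P (prob_power P n)) //.
congr (_ _); apply/seteqP; split => [[x s] /= h|[x s] [/= hx hs] i].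
  split => [|i]; first exact: h ord0.
  by have := h (lift ord0 i); rewrite tnthS.
case: (unliftP ord0 i) => [j ->|->]; last exact: hx.
by rewrite tnthS; exact: hs.
Qed.

End ProductPower.

(* N(0, sigma^2 I_d): independent coordinates, each N(0, sigma^2).  The second
   argument of normal_prob is the standard deviation. *)
Definition isotropic_normal {R : realType} (d : nat) (sigma : R) :
    probability (euclid R d) R :=
  prob_power (normal_prob 0 sigma : probability (measurableTypeR R) R) d.

(* With lne 0 = -oo.  The negative part of the integrand is always
   Q-integrable, so the integral is the usual element of [0, +oo]. *)
Definition KL_divergence {dT : measure_display} {T : measurableType dT}
    {R : realType} (Q P : probability T R) : \bar R :=
  if `[< Q `<< P >] then
    (\int[Q]_x lne (Radon_Nikodym (charge_of_finite_measure Q) P x))%E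
  else +oo%E.

Section Risks.
Context {dX : measure_display} {X : measurableType dX} {R : realType}.
Implicit Types (L : R -> R -> R) (h : X -> R).

(* L_D(h); extended-real valued because the loss need not be integrable. *)
Definition risk L (D : probability (X * measurableTypeR R)%type R) h : \bar R :=
  (\int[D]_p (L (h p.1) p.2)%:E)%E.

Definition empirical_risk L n (S : n.-tuple (X * measurableTypeR R)) h : R :=
  n%:R^-1 * \sum_(i < n) L (h (tnth S i).1) (tnth S i).2.

End Risks.

(* A distribution on A (with the trace sigma-algebra, A an arbitrary subset)
   is the same thing as a distribution on the whole space for which every
   measurable set disjoint from A is null.  For measurable A this says that
   the complement of A is null. *)
Definition concentrated_on {dT : measure_display} {T : measurableType dT}
    {R : realType} (D : probability T R) (A : set T) : Prop :=
  forall B : set T, measurable B -> B `&` A = set0 -> D B = 0%E.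

(* The event E, described by a predicate that need not be measurable, contains
   a measurable event of probability at least p. *)
Definition holds_with_prob_ge {dT : measure_display} {T : measurableType dT}
    {R : realType} (P : probability T R) (p : R) (E : set T) : Prop :=
  exists B : set T, [/\ measurable B, (p%:E <= P B)%E & B `<=` E].

(* Main.v *)
Require Import Defs.
From HB Require Import structures.
From mathcomp Require Import all_boot all_order all_algebra.
From mathcomp Require Import all_classical all_reals all_analysis.
From mathcomp Require Import measurable_realfun ring lra.
Import Order.TTheory GRing.Theory Num.Theory.
Import numFieldNormedType.Exports.
Local Open Scope classical_set_scope.
Local Open Scope ring_scope.

(** PAC-Bayes with the loss split as [L(h_w) = L(h_0) + Delta_w].  Almost surely
    [|Delta_w| <= M |w|], so by Hoeffding's lemma the exponential moment over
    the sample of [lambda (L_D - L_S)(Delta_w)] is at most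
    [exp (lambda^2 M^2 |w|^2 / (2 n))].  The choice
    [lambda = sqrt n / (M sigma sqrt (d + 1))] turns this into
    [exp (|w|^2 / (2 sigma^2 (d + 1)))], whose mean under [N(0, sigma^2 I_d)] is
    [(1 + 1/d)^(d/2) <= exp (1/2)].  Tonelli and Markov give, with probability
    [1 - delta/2], a bound on the Gaussian mean of the exponential, which the
    Donsker-Varadhan inequality transfers to all [Q] at once.  The remaining
    term [L(h_0) = |y|], in [0, Ymax], is controlled by Hoeffding's inequality
    with probability [1 - delta/2].  If [M = 0] then almost surely
    [Delta_w = 0] and only the second part is needed. *)

(** * Hoeffding's lemma, from Bernoulli variables to bounded functions *)

Lemma le_is_derive_ge0 (R : realType) (f f' : R -> R) (a b : R) :
  (forall x : R, is_derive x 1 f (f' x)) ->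
  (forall x, a < x -> 0 <= f' x) -> a <= b -> f a <= f b.
Proof.
move=> df f'0 ab.
apply: (@ger0_derive1_ndecry _ f a) => // [x|].
- rewrite in_itv/= andbT => /f'0; rewrite derive1E.
  by have -> := @derive_val _ _ _ _ _ _ _ (df x).
- apply: continuous_subspaceT => x; apply: differentiable_continuous.
  by apply/derivable1_diffP; case: (df x).
Qed.

(** Second-order comparison at 0: the logarithmic gap [F] between the two sides has [F 0 = 0],
    [F' = G] with [G 0 = 0], and [F'' = 1/4 - q (1 - q) >= 0], where [q = p e^x / Z x] is the tilted
    Bernoulli parameter. *)
Lemma bernoulli_mgf_le_of_ge0 (R : realType) (p h : R) : 0 <= p <= 1 -> 0 <= h ->
  1 - p + p * expR h <= expR (p * h + h ^+ 2 / 8).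
Proof.
move=> /andP[p0 p1] h0.
pose Z (x : R) : R := 1 - p + p * expR x.
have Zgt0 x : 0 < Z x.
  rewrite /Z; have [->|pn0] := eqVneq p 0; first by rewrite subr0 mul0r addr0.
  by rewrite ltr_wpDl ?subr_ge0// mulr_gt0 ?expR_gt0// lt_neqAle eq_sym pn0.
have dZ (x : R) : is_derive x 1 Z (p * expR x).
  rewrite /Z; apply: is_derive_eq.
  rewrite /GRing.scale/=; ring.
pose F (x : R) : R := p * x + x ^+ 2 / 8 - ln (Z x).
pose G (x : R) : R := p + x / 4 - p * expR x / Z x.
have dF (x : R) : is_derive x 1 F (G x).
  have dlnZ := is_derive1_comp (is_derive1_ln (Zgt0 x)) (dZ x).
  rewrite /F; apply: is_derive_eq.
  rewrite /GRing.scale/= /G; field.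
  by rewrite gt_eqF//.
have dG (x : R) : is_derive x 1 G (1 / 4 - p * expR x * (1 - p) / Z x ^+ 2).
  have Zn0 : Z x != 0 by rewrite gt_eqF.
  have dV := is_deriveV Zn0 (dZ x).
  rewrite /G; apply: is_derive_eq.
  rewrite /GRing.scale/=; rewrite /Z; field.
  by [].
have G_ge0 (x : R) : 0 <= x -> 0 <= G x.
  move=> x0; have <- : G 0 = 0.
    by rewrite /G /Z expR0 mulr1 subrK divr1 mul0r addr0 subrr.
  apply: le_is_derive_ge0 dG _ x0 => y _.
  rewrite subr_ge0 ler_pdivrMr ?exprn_gt0//.
  (* AM-GM for the two summands of [Z y]: four times their product is at most [Z y ^+ 2]. *)
  have := sqr_ge0 (1 - p - p * expR y); rewrite /Z; nra.
have : F 0 <= F h by apply: le_is_derive_ge0 dF _ h0 => y /ltW; exact: G_ge0.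
rewrite {1}/F /Z expR0 mulr1 subrK ln1 mulr0 expr0n mul0r addr0 subr0 subr_ge0.
by rewrite -ler_expR lnK// posrE.
Qed.

Lemma bernoulli_mgf_le (R : realType) (p h : R) : 0 <= p <= 1 ->
  (1 - p) * expR (- p * h) + p * expR ((1 - p) * h) <= expR (h ^+ 2 / 8).
Proof.
move=> p01.
(* Swapping the two outcomes sends [(p, h)] to [(1 - p, - h)] and preserves the claim. *)
wlog h0 : p h p01 / 0 <= h.
  move=> H; have [|/ltW h0] := leP 0 h; first exact: H.
  have : 0 <= 1 - p <= 1 by case/andP: p01 => p0 p1; rewrite subr_ge0 p1 gerBl.
  move=> /(H _ (- h)); rewrite oppr_ge0 sqrrN subKr mulrNN mulrN -mulNr => /(_ h0).
  by rewrite addrC.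
have := bernoulli_mgf_le_of_ge0 _ _ _ p01 h0.
rewrite -(ler_pM2l (expR_gt0 (- p * h))) -expRD mulNr addKr; apply: le_trans.
rewrite mulrDr mulrC mulrCA -expRD lerD2l.
by rewrite (_ : _ + h = (1 - p) * h)//; ring.
Qed.

Lemma expR_le_chord (R : realType) (a b z t : R) : a < b -> a <= z <= b ->
  expR (t * z) <= (b - z) / (b - a) * expR (t * a) + (z - a) / (b - a) * expR (t * b).
Proof.
move=> ab /andP[az zb].
have ba0 : 0 < b - a by rewrite subr_gt0.
have q01 : 0 <= (b - z) / (b - a) <= 1.
  rewrite divr_ge0 ?subr_ge0 ?(ltW ab)//= ler_pdivrMr// mul1r.
  by rewrite lerD2l lerN2.
pose q : {i01 R} := Itv01 (proj1 (andP q01)) (proj2 (andP q01)).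
have := convex_expR q (t * a) (t * b).
rewrite !convRE/= /unstable.onem.
rewrite (_ : 1 - (b - z) / (b - a) = (z - a) / (b - a)); last first.
  by field; rewrite gt_eqF.
rewrite (_ : _ + _ * (t * b) = t * z)//.
by field; rewrite gt_eqF.
Qed.

Lemma probability_integral_cst d (T : measurableType d) (R : realType)
    (P : probability T R) (c : R) : (\int[P]_x c%:E = c%:E)%E.
Proof. by rewrite -[RHS]mule1 -(probability_setT P) -integral_cst. Qed.

Lemma ae_bounded_integrable d (T : measurableType d) (R : realType)
    (P : probability T R) (g : T -> R) (c : R) :
  measurable_fun setT g -> {ae P, forall x, `|g x| <= c} ->
  P.-integrable setT (EFin \o g).
Proof.
move=> mg gc; apply/integrableP; split; first exact/measurable_EFinP.
apply: (@le_lt_trans _ _ (`|c|%:E * P setT)%E).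
  apply: integral_le_bound => //; first exact/measurable_EFinP.
  apply: filterS gc => x gx _ /=; rewrite lee_fin (le_trans gx)//.
  exact: ler_norm.
by rewrite probability_setT mule1 ltry.
Qed.

(** Replacing the exponential by its chord over [[a, b]] makes the integrand affine in [g], so its
    integral depends only on the mean [m]. What results is the moment generating function of a
    centred Bernoulli variable. *)
Lemma bounded_mgf_le d (T : measurableType d) (R : realType)
    (P : probability T R) (g : T -> R) (a b t : R) :
  measurable_fun setT g -> (forall x, a <= g x <= b) ->
  (\int[P]_x (expR (t * (\int[P]_y g y - g x)))%:E <=
   (expR ((t * (b - a)) ^+ 2 / 8))%:E)%E.
Proof.
move=> mg gab.
have ig : P.-integrable setT (EFin \o g).
  apply: (@ae_bounded_integrable _ _ _ _ _ (Num.max (- a) b)) => //.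
  apply: nearW => x; have /andP[ag gb] := gab x.
  by rewrite ler_norml lerNl !le_max lerN2 ag gb orbT.
have cint := probability_integral_cst _ _ _ P.
have icst c : P.-integrable setT (EFin \o cst c).
  exact: finite_measure_integrable_cst.
have mE : (\int[P]_x g x)%:E = (\int[P]_x (g x)%:E)%E.
  by rewrite /Rintegral fineK// integrable_fin_num.
set m := (\int[P]_y g y) in mE *.
have am : a <= m.
  rewrite -lee_fin mE -(cint a); apply: le_integral (icst a) ig _ => // x _.
  by have /andP[] := gab x.
have mb : m <= b.
  rewrite -lee_fin mE -(cint b); apply: le_integral ig (icst b) _ => // x _.
  by have /andP[] := gab x.
have mexp c : measurable_fun setT (fun x => (expR (t * (c - g x)))%:E).
  apply/measurable_EFinP/measurableT_comp => //; apply: measurable_funM => //.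
  exact: measurable_funB.
(* If [b <= a], the chord is undefined, but [g] is then constantly [m]. *)
have [ab|ba] := ltP a b; last first.
  under eq_integral => x _.
    rewrite (_ : g x = m); last first.
      have /andP[ag gb] := gab x; apply/eqP; rewrite eq_le.
      by rewrite (le_trans gb (le_trans ba am)) (le_trans mb (le_trans ba ag)).
    rewrite subrr mulr0 expR0; over.
  by rewrite cint lee_fin -expR0 ler_expR divr_ge0// sqr_ge0.
have ba0 : 0 < b - a by rewrite subr_gt0.
(* The chord through the values at [a] and [b] is [(b A - a B) + (B - A) g]. *)
pose A := expR (t * (m - a)) / (b - a).
pose B := expR (t * (m - b)) / (b - a).
apply: (@le_trans _ _ (\int[P]_x ((b * A - a * B) + (B - A) * g x)%:E)%E).
  apply: ge0_le_integral => //.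
  - apply/measurable_EFinP/measurable_funD => //.
    exact: measurable_funM.
  - move=> x _; rewrite lee_fin.
    have eD z : expR (t * (m - z)) = expR (t * m) * expR (- t * z).
      by rewrite -expRD mulNr mulrBr.
    rewrite eD; apply: (@le_trans _ _ (expR (t * m) *
        ((b - g x) / (b - a) * expR (- t * a) +
         (g x - a) / (b - a) * expR (- t * b)))).
      by rewrite ler_pM2l ?expR_gt0// expR_le_chord.
    by rewrite le_eqVlt; apply/orP; left; apply/eqP; rewrite /A /B !eD; ring.
under eq_integral do rewrite EFinD EFinM.
rewrite integralD//=; [|exact: icst|exact: integrableZl].
rewrite cint integralZl// -mE -EFinM -EFinD lee_fin.
(* The weight at [b] of the law on [{a, b}] with mean [m]. *)
pose p := (m - a) / (b - a).
have p01 : 0 <= p <= 1.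
  by rewrite divr_ge0 ?subr_ge0 ?(ltW ab)//= ler_pdivrMr// mul1r lerD2r.
have := bernoulli_mgf_le _ p (- (t * (b - a))) p01; rewrite sqrrN.
apply: le_trans; rewrite le_eqVlt; apply/orP; left; apply/eqP.
rewrite (_ : - p * _ = t * (m - a)); last by rewrite /p; field; rewrite gt_eqF.
rewrite (_ : (1 - p) * - _ = t * (m - b)); last by rewrite /p; field; rewrite gt_eqF.
by rewrite /A /B /p; field; rewrite gt_eqF.
Qed.

(* Truncating [g] to [a, b] changes it only on a null set. *)
Lemma hoeffding_mgf_le d (T : measurableType d) (R : realType)
    (P : probability T R) (g : T -> R) (a b t : R) :
  measurable_fun setT g -> {ae P, forall x, a <= g x <= b} ->
  (\int[P]_x (expR (t * (\int[P]_y g y - g x)))%:E <=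
   (expR ((t * (b - a)) ^+ 2 / 8))%:E)%E.
Proof.
move=> mg gab.
have ab : a <= b.
  rewrite leNgt; apply/negP => ba.
  have /eqP : P setT = 0%E.
    apply/negligibleP => //; apply: negligibleS gab => x _ /= /andP[ag gb].
    by have := le_lt_trans (le_trans ag gb) ba; rewrite ltxx.
  by rewrite probability_setT onee_eq0.
pose g' x := Num.max a (Num.min b (g x)).
have mg' : measurable_fun setT g'.
  by apply: measurable_maxr => //; exact: measurable_minr.
have gg' : {ae P, forall x, g x = g' x}.
  apply: filterS gab => x /andP[ag gb].
  by rewrite /g' (min_idPr gb) (max_idPr ag).
have mE (h : T -> R) c : measurable_fun setT h ->
    measurable_fun setT (fun x => (expR (t * (c - h x)))%:E).
  move=> mh; apply/measurable_EFinP/measurableT_comp => //.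
  by apply: measurable_funM => //; exact: measurable_funB.
have -> : \int[P]_y g y = \int[P]_y g' y.
  congr fine; apply: ae_eq_integral => //; try exact/measurable_EFinP.
  by apply: filterS gg' => x + _ => ->.
rewrite (_ : (\int[P]_x _)%E =
    (\int[P]_x (expR (t * (\int[P]_y g' y - g' x)))%:E)%E).
  apply: bounded_mgf_le => // x.
  by rewrite /g' le_max lexx/= ge_max ab/= ge_min lexx.
apply: ae_eq_integral => //; try exact: mE.
by apply: filterS gg' => x + _ => ->.
Qed.

(** * Change of measure and the Donsker-Varadhan inequality *)

Local Notation RN_density Q P :=
  (Radon_Nikodym (charge_of_finite_measure Q) P).

Section relative_entropy.
Context d (T : measurableType d) (R : realType) (P Q : probability T R).
Hypothesis QP : Q `<< P.
Let r : T -> \bar R := RN_density Q P.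

Let r_fin x : r x \is a fin_num.
Proof. exact: Radon_Nikodym_fin_num. Qed.

Let mr : measurable_fun setT r.
Proof. exact: measurable_int (Radon_Nikodym_integrable _). Qed.

Let mfr : measurable_fun setT (fine \o r).
Proof. exact: measurableT_comp. Qed.

Lemma measurable_lne_density : measurable_fun setT (@lne R \o r).
Proof.
rewrite (_ : _ \o _ = fun x => if (fine (r x) <= 0)%R then -oo%E
    else (ln (fine (r x)))%:E); last first.
  by apply/funext => x /=; case: (r x) (r_fin x).
apply: measurable_fun_ifT => //; first exact: measurable_fun_ler.
by apply/measurable_EFinP/measurableT_comp => //; exact: measurable_ln.
Qed.

(** The set [N] where [r <= 0] has [Q]-mass equal to the integral of [r] over [N] under [P], which
    is at most 0. *)
Lemma density_gt0_ae : {ae Q, forall x, 0 < fine (r x)}.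
Proof.
pose N := [set x | r x <= 0]%E.
have mN : measurable N.
  by rewrite -[N]setTI; exact: measurable_lee mr (measurable_cst _).
exists N; split => //.
  apply/eqP; rewrite eq_le measure_ge0 andbT.
  rewrite [leLHS](_ : _ = \int[P]_(x in N) r x)%E; last first.
    exact: (@Radon_Nikodym_integral _ _ _ (charge_of_finite_measure Q) P N QP mN).
  have r0 x : N x -> (0 <= - r x)%E by rewrite oppe_ge0.
  under eq_integral do rewrite -[r _]oppeK.
  by rewrite integral_ge0N// oppe_le0 integral_ge0.
by move=> x /= /negP; rewrite -leNgt /N/= -lee_fin fineK.
Qed.

(** Under [dQ = r dP] the factor [exp (- ln r) = 1 / r] cancels the density. Only an inequality
    survives, because the region [r = 0] contributes nothing on the left. *)
Lemma integral_expR_sub_ln_density_le (phi : T -> R) : measurable_fun setT phi ->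
  (\int[Q]_x (expR (phi x - ln (fine (r x))))%:E <= \int[P]_x (expR (phi x))%:E)%E.
Proof.
move=> mphi.
have mG : measurable_fun setT (fun x => (expR (phi x - ln (fine (r x))))%:E).
  apply/measurable_EFinP/measurableT_comp => //; apply: measurable_funB => //.
  by apply: measurableT_comp mfr; exact: measurable_ln.
rewrite -(Radon_Nikodym_SigmaFinite.change_of_variables QP)//.
pose f := Radon_Nikodym_SigmaFinite.f Q P.
have f0 : forall x, (0 <= f x)%E by exact: Radon_Nikodym_SigmaFinite.f_ge0.
apply: ae_ge0_le_integral => //.
- by move=> x _; rewrite mule_ge0// lee_fin expR_ge0.
- apply: emeasurable_funM => //.
  exact: measurable_int (Radon_Nikodym_SigmaFinite.f_integrable QP).
- by apply/measurable_EFinP/measurableT_comp.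
(* [r] agrees [P]-almost everywhere with [f], which is nonnegative everywhere. *)
have := ae_eq_Radon_Nikodym_SigmaFinite QP measurableT.
apply: filterS => x /(_ I) fr _; have := f0 x; rewrite /f fr.
rewrite -/(r x) -(fineK (r_fin x)) -EFinM !lee_fin le_eqVlt => /predU1P[<-|r0].
  by rewrite mulr0 expR_ge0.
by rewrite expRB lnK// divfK// gt_eqF.
Qed.

Lemma KL_divergenceE : KL_divergence Q P = (\int[Q]_x lne (r x))%E.
Proof. by rewrite /KL_divergence; case: ifPn => // /asboolPn. Qed.

(* The Donsker-Varadhan inequality for [u - v]. The convexity bound
   [u - v <= ln r + exp (u - v - ln r) - 1] is integrated after moving every
   negative term to the other side, so no integrability is required. *)
Lemma ge0_donsker_varadhan_dominated (u v : T -> R) :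
  measurable_fun setT u -> measurable_fun setT v ->
  (forall x, 0 <= u x) -> (forall x, 0 <= v x) ->
  (\int[P]_x (expR (u x - v x))%:E <= 1)%E ->
  (\int[Q]_x (u x)%:E <= \int[Q]_x (v x)%:E + KL_divergence Q P)%E.
Proof.
move=> mu mv u0 v0 exp_le1.
pose l := @lne R \o r.
have ml : measurable_fun setT l := measurable_lne_density.
have mlp : measurable_fun setT (funepos l) by exact: measurable_funepos.
have mln : measurable_fun setT (funeneg l) by exact: measurable_funeneg.
have mlnr : measurable_fun setT (fun x => ln (fine (r x))).
  by apply: measurableT_comp mfr; exact: measurable_ln.
(* The negative part of [ln r] is at most [exp (- ln r)], whose [Q]-integral is at most 1 by the
   previous lemma with [phi = 0]. Its finiteness allows the subtraction that forms the divergence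
   below. *)
have neg_le1 : (\int[Q]_x funeneg l x <= 1)%E.
  apply: (@le_trans _ _ (\int[P]_x (expR 0)%:E)%E); last first.
    by rewrite expR0 probability_integral_cst.
  apply: le_trans (integral_expR_sub_ln_density_le (cst 0) _) => //.
  apply: ae_ge0_le_integral => //.
  - by apply/measurable_EFinP/measurableT_comp => //; exact: measurable_funB.
  apply: filterS density_gt0_ae => x rx0 _; rewrite funenegE /l/=.
  rewrite -(fineK (r_fin x)) lne_EFin// -EFinN ge_max lee_fin sub0r.
  rewrite lee_fin expR_ge0 andbT (le_trans _ (expR_ge1Dx _))//.
  by rewrite lerDr ler01.
have F_le1 :=
  le_trans (integral_expR_sub_ln_density_le (fun x => u x - v x) _) exp_le1.
have mF : measurable_fun setT (fun x => (expR (u x - v x - ln (fine (r x))))%:E).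
  apply/measurable_EFinP/measurableT_comp => //.
  by apply: measurable_funB => //; exact: measurable_funB.
have step : (\int[Q]_x ((u x)%:E + funeneg l x + 1) <=
    \int[Q]_x ((v x)%:E + funepos l x + (expR (u x - v x - ln (fine (r x))))%:E))%E.
  apply: ae_ge0_le_integral => //.
  - by move=> x _; rewrite !adde_ge0// lee_fin.
  - apply: emeasurable_funD => //; apply: emeasurable_funD => //.
    exact/measurable_EFinP.
  - by move=> x _; rewrite !adde_ge0// ?lee_fin// expR_ge0.
  - apply: emeasurable_funD => //; apply: emeasurable_funD => //.
    exact/measurable_EFinP.
  apply: filterS density_gt0_ae => x rx0 _.
  rewrite funeposE funenegE /l/= -(fineK (r_fin x)) lne_EFin//=.
  set L := ln _; have := expR_ge1Dx (u x - v x - L).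
  rewrite -!EFin_max -!EFinD lee_fin.
  by rewrite /Num.max; case: ifP; case: ifP; lra.
have ip : (0 <= \int[Q]_x funepos l x)%E by exact: integral_ge0.
have iv : (0 <= \int[Q]_x (v x)%:E)%E by apply: integral_ge0 => x _; rewrite lee_fin.
have ineg : (0 <= \int[Q]_x funeneg l x)%E by exact: integral_ge0.
have mu' : measurable_fun setT (fun x => (u x)%:E) by exact/measurable_EFinP.
have mv' : measurable_fun setT (fun x => (v x)%:E) by exact/measurable_EFinP.
have u0' x : (0 <= (u x)%:E)%E by rewrite lee_fin.
have v0' x : (0 <= (v x)%:E)%E by rewrite lee_fin.
have ineg_fin : (\int[Q]_x funeneg l x)%E \is a fin_num.
  by rewrite ge0_fin_numE// (le_lt_trans neg_le1)// ltry.
have mun : measurable_fun setT (fun x => ((u x)%:E + funeneg l x)%E).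
  exact: emeasurable_funD.
have mvp : measurable_fun setT (fun x => ((v x)%:E + funepos l x)%E).
  exact: emeasurable_funD.
move: step; rewrite !ge0_integralD//;
  [|by move=> x _; rewrite adde_ge0..].
rewrite probability_integral_cst KL_divergenceE.
(* The divergence is split into positive and negative parts; the finite negative part moves to the
   left, and the 1 there absorbs the exponential term. *)
rewrite [X in _ -> (_ <= _ + X)%E]integralE -/l addeA leeBrDr// => step.
rewrite -(leeD2rE _ _ (erefl : 1%E \is a fin_num)) (le_trans step)// leeD2l//.
by apply: F_le1; exact: measurable_funB.
Qed.

End relative_entropy.

Lemma ge0_donsker_varadhan d (T : measurableType d) (R : realType)
    (P Q : probability T R) (u v : T -> R) :
  measurable_fun setT u -> measurable_fun setT v ->
  (forall x, 0 <= u x) -> (forall x, 0 <= v x) ->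
  (\int[P]_x (expR (u x - v x))%:E <= 1)%E ->
  (\int[Q]_x (u x)%:E <= \int[Q]_x (v x)%:E + KL_divergence Q P)%E.
Proof.
move=> mu mv u0 v0 le1; have [QP|nQP] := pselect (Q `<< P).
  exact: ge0_donsker_varadhan_dominated.
(* Without absolute continuity the divergence is [+oo], and adding the nonnegative integral of [v]
   keeps it so. *)
rewrite /KL_divergence; case: ifPn => [/asboolP//|_].
rewrite addey ?leey// gt_eqF// (lt_le_trans (ltNyr 0))//.
by apply: integral_ge0 => x _; rewrite lee_fin.
Qed.

Lemma KL_divergence_ge0 d (T : measurableType d) (R : realType)
    (P Q : probability T R) : (0 <= KL_divergence Q P)%E.
Proof.
have := ge0_donsker_varadhan _ _ _ P Q (cst 0) (cst 0).
rewrite /= subrr expR0 !probability_integral_cst add0e; apply => //.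
Qed.

(** * Integrals against product and Gaussian measures *)

Lemma ge0_integral_prob_power_prod d (T : measurableType d) (R : realType)
    (P : probability T R) (n : nat) (g : T -> R) :
  measurable_fun setT g -> (forall x, 0 <= g x) ->
  (\int[prob_power P n]_s (\prod_(i < n) g (tnth s i))%:E =
   (\int[P]_x (g x)%:E) ^+ n)%E.
Proof.
move=> mg g0.
have mprod m : measurable_fun setT
    (fun s : m.-tuple T => (\prod_(i < m) g (tnth s i))%:E).
  apply/measurable_EFinP; apply: measurable_prod => i _.
  by apply: measurableT_comp => //; exact: measurable_tnth.
have prod0 m (s : m.-tuple T) : (0 <= (\prod_(i < m) g (tnth s i))%:E)%E.
  by rewrite lee_fin prodr_ge0.
elim: n => [|n IH].
  rewrite expe0; under eq_integral do rewrite big_ord0.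
  exact: probability_integral_cst.
(* [prob_power P n.+1] is the image of a binary product under [tuple_cons], so Tonelli peels off the
   head coordinate. *)
rewrite expeS /= ge0_integral_distribution; [|exact: mprod|exact: prod0].
rewrite fubini_tonelli1; last 2 first.
- by apply: measurableT_comp; [exact: mprod|exact: measurable_tuple_cons].
- by move=> x; exact: prod0.
rewrite /fubini_F.
under eq_integral => x _.
  under eq_integral => s _.
    rewrite /= big_ord_recl (_ : tnth _ ord0 = x)//.
    under eq_bigr do rewrite tnthS.
    rewrite EFinM; over.
  rewrite ge0_integralZl//; [|exact: mprod|by rewrite lee_fin].
  rewrite IH; over.
rewrite ge0_integralZr//; first exact/measurable_EFinP.
- by move=> x _; rewrite lee_fin.
- by rewrite -IH integral_ge0.
Qed.

(** [normal_pdf] and the Radon-Nikodym derivative have the same integral over every measurable set,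
    hence agree almost everywhere. *)
Lemma ge0_integral_normal_prob (R : realType) (m s : R) (f : R -> \bar R) :
  measurable_fun setT f -> (forall x, 0 <= f x)%E ->
  (\int[normal_prob m s]_x f x =
   \int[lebesgue_measure]_x (f x * (normal_pdf m s x)%:E))%E.
Proof.
move=> mf f0.
have dom := normal_prob_dominates m s.
rewrite -(Radon_Nikodym_SigmaFinite.change_of_variables dom)//.
have mpdf : measurable_fun setT (fun x => (normal_pdf m s x)%:E).
  by apply/measurable_EFinP; exact: measurable_normal_pdf.
have iRN := Radon_Nikodym_SigmaFinite.f_integrable dom.
apply: ae_eq_integral => //.
- exact: emeasurable_funM (measurable_int _ iRN).
- exact: emeasurable_funM.
apply: ae_eqe_mul2l; apply: integral_ae_eq => // A _ mA.
by rewrite -Radon_Nikodym_SigmaFinite.f_integral.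
Qed.

(* [k * s] is the standard deviation of the Gaussian obtained by tilting. *)
Lemma normal_sqr_mgf (R : realType) (s k : R) : 0 < s -> 0 < k ->
  (\int[normal_prob 0 s]_x (expR ((1 - k ^- 2) * (x ^+ 2 / (2 * s ^+ 2))))%:E
   = k%:E)%E.
Proof.
move=> s0 k0; have sn0 : s != 0 by rewrite gt_eqF.
have ksn0 : k * s != 0 by rewrite mulf_neq0// gt_eqF.
rewrite ge0_integral_normal_prob; last 2 first.
- apply/measurable_EFinP/measurableT_comp => //; apply: measurable_funM => //.
  by apply: measurable_funM => //; exact: measurable_funX.
- by move=> x; rewrite lee_fin expR_ge0.
transitivity (\int[lebesgue_measure]_x (k%:E * (normal_pdf 0 (k * s) x)%:E))%E;
  last first.
  rewrite ge0_integralZl//; last 3 first.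
  - by apply/measurable_EFinP; exact: measurable_normal_pdf.
  - by move=> x _; rewrite lee_fin normal_pdf_ge0.
  - by rewrite lee_fin ltW.
  by rewrite integral_normal_pdf mule1.
apply: eq_integral => x _.
rewrite -!EFinM !normal_pdfE//; congr EFin.
rewrite [LHS]mulrCA -expRD [RHS]mulrA; congr (_ * expR _).
  rewrite /normal_peak (_ : (k * s) ^+ 2 * pi *+ 2 = k ^+ 2 * (s ^+ 2 * pi *+ 2)).
    by rewrite sqrtrM ?sqr_ge0// sqrtr_sqr gtr0_norm// invfM mulVKf// gt_eqF.
  by ring.
rewrite !subr0; field.
by rewrite sn0 gt_eqF.
Qed.

Lemma isotropic_normal_sqr_mgf_le (R : realType) (d : nat) (s : R) : 0 < s ->
  (\int[isotropic_normal d s]_w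
     (expR (dotp w w / (2 * s ^+ 2 * d.+1%:R)))%:E <= (expR (1 / 2))%:E)%E.
Proof.
(* With [k ^+ 2 = (d + 1) / d] the tilt [1 - k ^- 2] is [1 / (d + 1)], and each coordinate
   contributes a factor [k]. *)
move=> s0; pose k : R := Num.sqrt (d.+1%:R / d%:R).
(* For [d = 0] division by zero would give [k = 0]; the integrand is then constantly 1. *)
case: (posnP d) => [d0|d0].
  rewrite (eq_integral (cst 1%:E)).
    by rewrite probability_integral_cst lee_fin -expR0 ler_expR.
  move=> w _; rewrite /dotp big1 ?mul0r ?expR0// => i _.
  by exfalso; case: i => i; rewrite d0.
have d0' : 0 < d%:R :> R by rewrite ltr0n.
have k0 : 0 < k by rewrite sqrtr_gt0 divr_gt0.
rewrite (eq_integral (fun w : euclid R d => (\prod_(i < d)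
    expR ((1 - k ^- 2) * (tnth w i ^+ 2 / (2 * s ^+ 2))))%:E)); last first.
  move=> w _; rewrite -expR_sum; congr (expR _)%:E.
  rewrite -mulr_sumr -mulr_suml sqr_sqrtr; last by rewrite divr_ge0.
  rewrite (eq_bigr (fun i => tnth w i * tnth w i)) -/(dotp w w).
    by field; rewrite !gt_eqF// nat1r ltr0n.
  by move=> i _; rewrite expr2.
rewrite [leLHS](ge0_integral_prob_power_prod _ (measurableTypeR R) R
    (normal_prob 0 s) d (fun x : measurableTypeR R =>
      expR ((1 - k ^- 2) * (x ^+ 2 / (2 * s ^+ 2))))); last 2 first.
- apply: measurableT_comp => //; apply: measurable_funM => //.
  by apply: measurable_funM => //; exact: measurable_funX.
- by move=> x; exact: expR_ge0.
rewrite [X in (X ^+ d)%E](normal_sqr_mgf _ _ _ s0 k0) -EFin_expe lee_fin.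
(* The square root of [1 + 1/d <= exp (1/d)]; its [d]-th power is the claim. *)
have kE : k <= expR (1 / 2 / d%:R).
  rewrite -[leRHS]gtr0_norm ?expR_gt0// -sqrtr_sqr ler_wsqrtr//.
  rewrite -expRM_natl (_ : 2%:R * (1 / 2 / d%:R) = d%:R^-1); last first.
    by field; rewrite gt_eqF.
  by rewrite (le_trans _ (expR_ge1Dx _))// -natr1 mulrDl divff ?gt_eqF// mul1r.
rewrite (le_trans (lerXn2r _ _ _ kE)) ?nnegrE ?expR_ge0 ?(ltW k0)//.
by rewrite -expRM_natr divfK// gt_eqF.
Qed.

(** * High-probability events and concentration of sample means *)

Lemma holds_with_prob_ge_mono d (T : measurableType d) (R : realType)
    (P : probability T R) (p q : R) (E F : set T) : q <= p -> E `<=` F ->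
  holds_with_prob_ge P p E -> holds_with_prob_ge P q F.
Proof.
move=> qp EF [B [mB pB BE]]; exists B; split => //; last exact: subset_trans EF.
by rewrite (le_trans _ pB)// lee_fin.
Qed.

(** Union bound on the complements of the measurable witnesses. *)
Lemma holds_with_prob_geI d (T : measurableType d) (R : realType)
    (P : probability T R) (p q : R) (E F : set T) :
  holds_with_prob_ge P (1 - p) E -> holds_with_prob_ge P (1 - q) F ->
  holds_with_prob_ge P (1 - (p + q)) (E `&` F).
Proof.
move=> [A [mA pA AE]] [B [mB qB BF]]; exists (A `&` B); split.
- exact: measurableI.
- have cP C x : measurable C -> ((1 - x)%:E <= P C)%E = (P (~` C) <= x%:E)%E.
    move=> mC; rewrite probability_setC// EFinB leeBlDl// leeBlDr//.
    exact: fin_num_measure.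
  rewrite cP in pA => //; rewrite cP in qB => //.
  rewrite cP; last exact: measurableI.
  rewrite setCI EFinD.
  by rewrite (le_trans (measureU2 _ (measurableC mA) (measurableC mB)))// leeD.
- exact: setISS.
Qed.

Lemma markov_holds_with_prob_ge d (T : measurableType d) (R : realType)
    (P : probability T R) (F : T -> \bar R) (c delta : R) :
  measurable_fun setT F -> (forall x, 0 <= F x)%E -> 0 < c -> 0 < delta ->
  (\int[P]_x F x <= c%:E)%E ->
  holds_with_prob_ge P (1 - delta) [set x | (F x < (c / delta)%:E)%E].
Proof.
move=> mF F0 c0 delta0 Fc.
have cd0 : 0 < c / delta by rewrite divr_gt0.
pose A := [set x | ((c / delta)%:E <= F x)%E].
have mA : measurable A by rewrite -[A]setTI; exact: emeasurable_fun_c_infty.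
have PA : (P A <= delta%:E)%E.
  have := le_trans (le_integral_abse P measurableT mF cd0).
  under eq_integral do rewrite gee0_abs//.
  move=> /(_ _ Fc); rewrite setTI.
  rewrite (_ : [set x | _] = A); last first.
    by apply/seteqP; split => x /=; rewrite gee0_abs.
  rewrite -lee_pdivlMl// -EFinM invf_div => /le_trans; apply.
  by rewrite lee_fin divfK// gt_eqF.
exists (~` A); split.
- exact: measurableC.
- by rewrite probability_setC// EFinB leeB.
- by move=> x /negP; rewrite -ltNge.
Qed.

(** Carries an almost sure property of one draw to the whole sample; it serves the degenerate cases
    of a constant loss and of [M = 0]. *)
Lemma prob_power_forall_ae d (T : measurableType d) (R : realType)
    (P : probability T R) (n : nat) (A : set T) : measurable A -> P (~` A) = 0%E ->
  holds_with_prob_ge (prob_power P n) 1 [set s | forall i, A (tnth s i)].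
Proof.
move=> mA PA0; exists [set s | forall i, A (tnth s i)]; split => //.
  rewrite (_ : [set s | _] =
      \bigcap_(i in [set: 'I_n]) ((fun s : n.-tuple T => tnth s i) @^-1` A)).
    apply: fin_bigcap_measurable => [|i _]; first exact: finite_finset.
    by rewrite -[X in measurable X]setTI; exact: measurable_tnth.
  by apply/seteqP; split => s /= h i; [move=> _|]; exact: h.
have PA1 : P A = 1%E.
  by rewrite -[A]setCK probability_setC ?PA0 ?sube0//; exact: measurableC.
rewrite (prob_power_box P (fun=> mA)).
by rewrite big1.
Qed.

Lemma measurable_sample_mean d (T : measurableType d) (R : realType)
    (n : nat) (g : T -> R) : measurable_fun setT g ->
  measurable_fun setT
    (fun s : n.-tuple T => n%:R^-1 * \sum_(i < n) g (tnth s i)).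
Proof.
move=> mg; apply: measurable_funM => //; apply: measurable_sum => i.
by apply: measurableT_comp => //; exact: measurable_tnth.
Qed.

(** The exponent splits over [n] independent draws, each with parameter [t / n]; Hoeffding's lemma
    gives [(t / n)^2] for each, so the [n] factors together leave a single [1 / n]. *)
Lemma sample_mean_mgf_le d (T : measurableType d) (R : realType)
    (P : probability T R) (n : nat) (g : T -> R) (a b t : R) : (0 < n)%N ->
  measurable_fun setT g -> {ae P, forall x, a <= g x <= b} ->
  (\int[prob_power P n]_s
     (expR (t * (\int[P]_x g x - n%:R^-1 * \sum_(i < n) g (tnth s i))))%:E <=
   (expR ((t * (b - a)) ^+ 2 / (8 * n%:R)))%:E)%E.
Proof.
move=> n_gt0 mg gab; have n0 : 0 < n%:R :> R by rewrite ltr0n.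
set m := \int[P]_x g x.
pose h x := expR (t / n%:R * (m - g x)).
have mh : measurable_fun setT h.
  apply: measurableT_comp => //; apply: measurable_funM => //.
  exact: measurable_funB.
rewrite (eq_integral (fun s : n.-tuple T => (\prod_(i < n) h (tnth s i))%:E)).
  rewrite ge0_integral_prob_power_prod//; last by move=> x; exact: expR_ge0.
  have := hoeffding_mgf_le _ _ _ _ _ _ _ (t / n%:R) mg gab; rewrite -/m -/h.
  set I := (\int[P]_x _)%E => Ile.
  have I0 : (0 <= I)%E by apply: integral_ge0 => x _; rewrite lee_fin expR_ge0.
  have Ifin : I \is a fin_num by rewrite ge0_fin_numE// (le_lt_trans Ile) ?ltry.
  move: Ile I0; rewrite -(fineK Ifin) -EFin_expe !lee_fin => Ile I0.
  rewrite (le_trans (lerXn2r _ _ _ Ile)) ?nnegrE ?expR_ge0//.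
  rewrite -expRM_natl ler_expR le_eqVlt; apply/orP; left; apply/eqP.
  by field; rewrite gt_eqF.
move=> s _; rewrite -expR_sum; congr (expR _)%:E.
rewrite -mulr_sumr sumrB sumr_const card_ord -[m *+ n]mulr_natr.
by field; rewrite gt_eqF.
Qed.

Lemma hoeffding_sample_mean d (T : measurableType d) (R : realType)
    (P : probability T R) (n : nat) (g : T -> R) (a b delta : R) : (0 < n)%N ->
  measurable_fun setT g -> {ae P, forall x, a <= g x <= b} ->
  0 < delta -> delta < 1 ->
  holds_with_prob_ge (prob_power P n) (1 - delta)
    [set s | \int[P]_x g x <= n%:R^-1 * \sum_(i < n) g (tnth s i)
      + (b - a) * Num.sqrt (ln delta^-1 / (2 * n%:R))].
Proof.
move=> n_gt0 mg gab delta0 delta1; have n0 : 0 < n%:R :> R by rewrite ltr0n.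
set m := \int[P]_x g x.
(* If [b <= a], then [g] is almost surely [a], and the bound holds on almost every sample. *)
have [ab|ba] := ltP a b; last first.
  pose A := [set x | a <= g x <= b].
  have mA : measurable A.
    rewrite (_ : A = [set x | a <= g x] `&` [set x | g x <= b]); last first.
      by apply/seteqP; split => x /=; [move/andP|move=> [? ?]; apply/andP].
    by apply: measurableI; rewrite -[X in measurable X]setTI;
      exact: measurable_fun_le.
  have PA0 : P (~` A) = 0%E by apply/negligibleP => //; exact: measurableC.
  apply: holds_with_prob_ge_mono (prob_power_forall_ae _ _ _ P n A mA PA0).
    by rewrite gerBl ltW.
  have gE x : A x -> g x = a.
    by move=> /andP[ag gb]; apply/eqP; rewrite eq_le ag (le_trans gb).
  have -> : m = a.
    rewrite /m /Rintegral -[RHS]/(fine a%:E) -(probability_integral_cst _ _ _ P a).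
    congr fine; apply: ae_eq_integral => //; first exact/measurable_EFinP.
    by apply: filterS gab => x /gE gx _; rewrite gx.
  move=> s sA /=; under eq_bigr do rewrite gE//.
  rewrite sumr_const card_ord -[a *+ n]mulr_natl mulKf ?gt_eqF// lerDl.
  (* A sample point in [A] witnesses [a <= b], so the deviation term is nonnegative. *)
  have /andP[ag gb] := sA (Ordinal n_gt0).
  by rewrite mulr_ge0// subr_ge0 (le_trans ag).
set l := ln delta^-1.
have l0 : 0 < l by rewrite ln_gt0// invf_gt1.
have ba0 : 0 < b - a by rewrite subr_gt0.
(* The Chernoff optimum: the exponent of the moment bound equals [l = ln (1/delta)], so Markov's
   threshold is [exp (2 l)] and the deviation is below [2 l / t]. *)
pose t := Num.sqrt (8 * n%:R * l) / (b - a).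
have t0 : 0 < t by rewrite divr_gt0// sqrtr_gt0 !mulr_gt0.
have tl : (t * (b - a)) ^+ 2 / (8 * n%:R) = l.
  rewrite divfK ?gt_eqF// sqr_sqrtr ?ltW ?mulr_gt0//.
  by field; rewrite gt_eqF.
have le_mgf := sample_mean_mgf_le _ _ _ P n g a b t n_gt0 mg gab.
rewrite tl -/m in le_mgf.
apply: holds_with_prob_ge_mono
  (markov_holds_with_prob_ge _ _ _ _ _ _ delta _ _ (expR_gt0 _) delta0 le_mgf) => //.
- move=> s /=; rewrite lte_fin.
  have -> : expR l / delta = expR (l + l) by 
    by rewrite expRD {3}/l lnK// posrE invr_gt0.
  rewrite ltr_expR -ltr_pdivlMl// => /ltW.
  rewrite lerBlDl (_ : t^-1 * (l + l) = (b - a) * Num.sqrt (l / (2 * n%:R)))//.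
  rewrite /t invf_div -[LHS]mulrA; congr (_ * _).
  apply: (mulIf (lt0r_neq0 (_ : 0 < Num.sqrt (8 * n%:R * l)))).
    by rewrite sqrtr_gt0 !mulr_gt0.
  rewrite mulrAC mulVf ?mul1r ?gt_eqF ?sqrtr_gt0 ?mulr_gt0// -sqrtrM; last first.
    by rewrite divr_ge0 ?mulr_ge0 ?ltW.
  rewrite (_ : l / (2 * n%:R) * (8 * n%:R * l) = (l + l) ^+ 2); last first.
    by field; rewrite gt_eqF.
  by rewrite sqrtr_sqr ger0_norm// addr_ge0 ?ltW.
- apply/measurable_EFinP/measurableT_comp => //; apply: measurable_funM => //.
  by apply: measurable_funB => //; exact: measurable_sample_mean.
Qed.

(** * PAC-Bayes bound for a loss within bounded distance of a reference loss *)

Section pac_bayes.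
Context dT dW (T : measurableType dT) (W : measurableType dW) (R : realType).
Variables (D : probability T R) (P : probability W R) (n : nat).
Variables (ell : W -> T -> R) (ell0 : T -> R) (B : W -> R) (lam K delta : R).
Hypothesis n_gt0 : (0 < n)%N.
Hypothesis mell : measurable_fun setT (fun p : W * T => ell p.1 p.2).
Hypothesis mell0 : measurable_fun setT ell0.
Hypothesis mB : measurable_fun setT B.
Hypothesis ell_ge0 : forall w x, 0 <= ell w x.
Hypothesis ell0_ge0 : forall x, 0 <= ell0 x.
Hypothesis ell0_int : D.-integrable setT (EFin \o ell0).
Hypothesis ell_close : forall w, {ae D, forall x, `|ell w x - ell0 x| <= B w}.
Hypotheses (lam_gt0 : 0 < lam) (K_ge0 : 0 <= K).
Hypotheses (delta_gt0 : 0 < delta) (delta_le1 : delta <= 1).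
Hypothesis exp_moment :
  (\int[P]_w (expR ((lam * (2 * B w)) ^+ 2 / (8 * n%:R)))%:E <= (expR K)%:E)%E.

Let LD w : R := \int[D]_x ell w x.
Let L0 : R := \int[D]_x ell0 x.
Let LS (s : n.-tuple T) w : R := n%:R^-1 * \sum_(i < n) ell w (tnth s i).
Let LS0 (s : n.-tuple T) : R := n%:R^-1 * \sum_(i < n) ell0 (tnth s i).

Let mell1 w : measurable_fun setT (ell w).
Proof. exact: (measurableT_comp mell (measurable_pair1 w)). Qed.

(** [ell w] is the integrable [ell0] plus an almost surely bounded function, so [LD w] is a genuine
    mean. *)
Let ell_int w : D.-integrable setT (EFin \o ell w).
Proof.
rewrite (_ : EFin \o ell w =
    (fun x => (ell w x - ell0 x)%R%:E + (ell0 x)%:E)%E).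
  apply: integrableD => //.
  apply: (ae_bounded_integrable _ _ _ _ _ (B w)) => //.
  exact: measurable_funB.
by apply/funext => x /=; rewrite -EFinD subrK.
Qed.

Let LDE w : (\int[D]_x (ell w x)%:E = (LD w)%:E)%E.
Proof.
rewrite /LD /Rintegral fineK//.
exact: (integrable_fin_num measurableT (ell_int w)).
Qed.

Let mLD : measurable_fun setT LD.
Proof.
apply: measurableT_comp => //.
apply: (measurable_fun_fubini_tonelli_F (fun p : W * T => (ell p.1 p.2)%:E)).
  exact/measurable_EFinP.
by move=> p; rewrite lee_fin.
Qed.

Let mLS : measurable_fun setT (fun p : n.-tuple T * W => LS p.1 p.2).
Proof.
apply: measurable_funM => //; apply: measurable_sum => i.
have mi : measurable_fun setT (fun p : n.-tuple T * W => (p.2, tnth p.1 i)).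
  apply: measurable_fun_pair => //=.
  by apply: (measurableT_comp (measurable_tnth i)).
exact: (measurableT_comp mell mi).
Qed.

(** The exponential of [lam] times the generalisation gap of the difference [ell w - ell0]. *)
Let f (p : n.-tuple T * W) : \bar R :=
  (expR (lam * (LD p.2 - L0 - (LS p.1 p.2 - LS0 p.1))))%:E.

Let mf : measurable_fun setT f.
Proof.
apply/measurable_EFinP/measurableT_comp => //; apply: measurable_funM => //.
apply: measurable_funB.
  apply: measurable_funB => //.
  by apply: (measurableT_comp mLD).
apply: measurable_funB => //.
by apply: (measurableT_comp (measurable_sample_mean _ _ _ n _ mell0)).
Qed.

Let f_ge0 p : (0 <= f p)%E.
Proof. by rewrite lee_fin expR_ge0. Qed.

(** [P] does not depend on the sample, so Tonelli lets the sample be integrated first. For fixed [w]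
    the difference lies in [[- B w, B w]], an interval of width [2 * B w]. *)
Let integral_f_le :
  (\int[prob_power D n]_s \int[P]_w f (s, w) <= (expR K)%:E)%E.
Proof.
rewrite fubini_tonelli//; apply: le_trans exp_moment.
apply: ge0_le_integral => //.
- by move=> w _; exact: integral_ge0.
- exact: (measurable_fun_fubini_tonelli_G f mf f_ge0).
- apply/measurable_EFinP/measurableT_comp => //; apply: measurable_funM => //.
  apply: measurable_funX; apply: measurable_funM => //.
  exact: measurable_funM.
move=> w _.
have := sample_mean_mgf_le _ _ _ D n (fun x => ell w x - ell0 x)
  (- B w) (B w) lam n_gt0.
rewrite (_ : B w - - B w = 2 * B w); last by ring.
rewrite (_ : \int[D]_x (ell w x - ell0 x) = LD w - L0); last first.
  by rewrite RintegralB.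
move=> H; apply: le_trans (H _ _).
- rewrite le_eqVlt; apply/orP; left; apply/eqP; apply: eq_integral => s _.
  rewrite /f /LS /LS0 /=. by rewrite -mulrBr -sumrB.
- exact: measurable_funB.
- by apply: filterS (ell_close w) => x; rewrite ler_norml.
Qed.

(** Donsker-Varadhan with [u = lam (LD + LS0)] and [v = lam (LS + L0) + c]. Placing [LS0] and [L0]
    on opposite sides keeps both functions nonnegative, so the [Q]-means of the risks may be
    infinite. *)
Lemma pac_bayes_bounded_gap :
  holds_with_prob_ge (prob_power D n) (1 - delta)
    [set s | forall Q : probability W R,
      (\int[Q]_w \int[D]_x (ell w x)%:E
       + (n%:R^-1 * \sum_(i < n) ell0 (tnth s i))%:E <=
       \int[Q]_w (n%:R^-1 * \sum_(i < n) ell w (tnth s i))%:E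
       + (\int[D]_x ell0 x)%:E
       + lam^-1%:E * (KL_divergence Q P + (ln delta^-1 + K)%:E))%E].
Proof.
have := markov_holds_with_prob_ge _ _ _ (prob_power D n)
  (fun s => \int[P]_w f (s, w))%E (expR K) delta.
move=> /(_ (measurable_fun_fubini_tonelli_F f mf f_ge0)).
move=> /(_ (fun s => integral_ge0 _ (fun w _ => f_ge0 _)) (expR_gt0 K)).
move=> /(_ delta_gt0 integral_f_le).
apply: holds_with_prob_ge_mono => // s /= fs Q.
(* The logarithm of Markov's threshold [exp K / delta]; subtracting it brings the exponential moment
   below 1. *)
set c := ln delta^-1 + K.
have c0 : 0 <= c by rewrite addr_ge0// ln_ge0// invf_ge1.
have LS0_ge0 : 0 <= LS0 s by rewrite mulr_ge0// sumr_ge0.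
have L0_ge0 : 0 <= L0 by exact: Rintegral_ge0.
have LS_ge0 w : 0 <= LS s w by rewrite mulr_ge0// sumr_ge0.
have LD_ge0 w : 0 <= LD w by exact: Rintegral_ge0.
have mLSs : measurable_fun setT (LS s).
  exact: (measurableT_comp mLS (measurable_pair1 s)).
have le1 : (\int[P]_w (expR (lam * LD w + lam * LS0 s
    - (lam * LS s w + (lam * L0 + c))))%:E <= 1)%E.
  rewrite (eq_integral (fun w => (expR (- c))%:E * f (s, w))%E); last first.
    move=> w _; rewrite /f/= -EFinM -expRD; congr (expR _)%:E; ring.
  rewrite ge0_integralZl//; last exact: (measurableT_comp mf (measurable_pair1 s)).
  have cE : expR K / delta = expR c.
    by rewrite expRD lnK ?posrE ?invr_gt0// mulrC.
  rewrite cE in fs.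
  apply: le_trans (lee_wpmul2l _ (ltW fs)) _; first by rewrite lee_fin expR_ge0.
  by rewrite -EFinM -expRD addNr expR0.
have := ge0_donsker_varadhan _ _ _ P Q _ _ _ _ _ _ le1.
have mu w0 : measurable_fun setT (fun w => lam * LD w + w0).
  by apply: measurable_funD => //; exact: measurable_funM.
have mv w0 : measurable_fun setT (fun w => lam * LS s w + w0).
  by apply: measurable_funD => //; exact: measurable_funM.
have lam_ge0 := ltW lam_gt0.
have u0 w : 0 <= lam * LD w + lam * LS0 s.
  by apply: addr_ge0; exact: mulr_ge0.
have z_ge0 : 0 <= lam * L0 + c by apply: addr_ge0 => //; exact: mulr_ge0.
have v0 w : 0 <= lam * LS s w + (lam * L0 + c).
  by apply: addr_ge0 => //; exact: mulr_ge0.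
move=> /(_ (mu _) (mv _) u0 v0).
have intD (g : W -> R) z : measurable_fun setT g -> (forall w, 0 <= g w) -> 0 <= z ->
    (\int[Q]_w (lam * g w + z)%:E = lam%:E * \int[Q]_w (g w)%:E + z%:E)%E.
  move=> mg g0 z0; under eq_integral do rewrite EFinD EFinM.
  have mg' : measurable_fun setT (fun w => (g w)%:E) by exact/measurable_EFinP.
  rewrite ge0_integralD//; last exact: measurable_funeM.
    rewrite probability_integral_cst ge0_integralZl ?lee_fin// => w _.
    by rewrite lee_fin.
  by move=> w _; rewrite mule_ge0 ?lee_fin.
rewrite !intD//; last exact: mulr_ge0.
have -> : (\int[Q]_w \int[D]_x (ell w x)%:E = \int[Q]_w (LD w)%:E)%E.
  by apply: eq_integral => w _; exact: LDE.
rewrite -/(LS0 s) -/(LS s) -/L0.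
have iLD0 : (0 <= \int[Q]_w (LD w)%:E)%E by apply: integral_ge0 => w _; rewrite lee_fin.
have iLS0 : (0 <= \int[Q]_w (LS s w)%:E)%E by apply: integral_ge0 => w _; rewrite lee_fin.
have KL0 := KL_divergence_ge0 _ _ _ P Q.
move: (\int[Q]_w (LD w)%:E)%E (\int[Q]_w (LS s w)%:E)%E (KL_divergence Q P)
  iLD0 iLS0 KL0.
have lamE : (0 < lam%:E)%E by rewrite lte_fin.
have lamVE : (0 < lam^-1%:E)%E by rewrite lte_fin invr_gt0.
(* If [y] or [k] is infinite the right side is [+oo]; if only [x] is, the premise fails. The finite
   case divides by [lam]. *)
move=> [x| |] [y| |] [k| |] //= x0 y0 k0;
  rewrite ?(gt0_muley lamE) ?(gt0_muley lamVE) //= ?leey ?leye_eq//.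
rewrite -!EFinM -!EFinD !lee_fin => H.
rewrite -(ler_pM2l lam_gt0) [leRHS]mulrDr mulVKf ?gt_eqF//.
lra.
Qed.

End pac_bayes.

(** * Euclidean norm: Cauchy-Schwarz and measurability *)

Section euclidean.
Context {R : realType} {d : nat}.
Implicit Types w x : euclid R d.

Lemma dotp_ge0 x : 0 <= dotp x x.
Proof. by rewrite sumr_ge0// => i _; rewrite -expr2 sqr_ge0. Qed.

Lemma enorm_sqr x : enorm x ^+ 2 = dotp x x.
Proof. by rewrite sqr_sqrtr// dotp_ge0. Qed.

Lemma dotp_cauchy_schwarz w x : `|dotp w x| <= enorm w * enorm x.
Proof.
rewrite -ler_sqr ?nnegrE ?mulr_ge0 ?sqrtr_ge0// exprMn !enorm_sqr real_normK ?num_real//.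
(* Lagrange's identity, doubled because the sum runs over ordered pairs of indices. *)
have lagrange : dotp w w * dotp x x + dotp x x * dotp w w - 2 * dotp w x ^+ 2 =
    \sum_i \sum_j (tnth w i * tnth x j - tnth w j * tnth x i) ^+ 2.
  rewrite expr2 !big_distrlr mulr_sumr -big_split/= -sumrB; apply: eq_bigr => i _.
  rewrite mulr_sumr -big_split/= -sumrB; apply: eq_bigr => j _; ring.
have : 0 <= \sum_i \sum_j (tnth w i * tnth x j - tnth w j * tnth x i) ^+ 2.
  by apply: sumr_ge0 => i _; apply: sumr_ge0 => j _; exact: sqr_ge0.
rewrite -lagrange; lra.
Qed.

Lemma measurable_dotp dT (T : measurableType dT) (f g : T -> euclid R d) :
  measurable_fun setT f -> measurable_fun setT g ->
  measurable_fun setT (fun t => dotp (f t) (g t)).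
Proof.
move=> mf mg; apply: measurable_sum => i.
by apply: measurable_funM; apply: (measurableT_comp (measurable_tnth i)).
Qed.

Lemma measurable_enorm : measurable_fun setT (@enorm R d).
Proof.
have msqrt : measurable_fun setT (@Num.sqrt R).
  by apply: continuous_measurable_fun; exact: sqrt_continuous.
apply: (measurableT_comp msqrt).
exact: measurable_dotp (@measurable_id _ _ _) (@measurable_id _ _ _).
Qed.

End euclidean.

(** * Linear predictors with absolute loss and a Gaussian prior *)

Theorem corollary4p5 (R : realType) (d n : nat) (M Ymax sigma delta : R)
    (X : set (euclid R d))
    (D : probability (euclid R d * measurableTypeR R)%type R)
    (n_gt0 : (0 < n)%N)
    (X_bounded : forall x, X x -> enorm x <= M)
    (D_on_X : concentrated_on D (X `*` setT))
    (y_bounded : {ae D, forall p, `|p.2| <= Ymax})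
    (sigma_gt0 : 0 < sigma)
    (delta_gt0 : 0 < delta) (delta_le1 : delta <= 1) :
  let P := isotropic_normal d sigma in
  holds_with_prob_ge (prob_power D n) (1 - delta)
    [set S | forall Q : probability (euclid R d) R,
      (\int[Q]_w risk absolute_loss D (linear_predictor w) <=
       \int[Q]_w (empirical_risk absolute_loss S (linear_predictor w))%:E
       + (M * sigma * Num.sqrt (d.+1)%:R / Num.sqrt n%:R)%:E
           * (KL_divergence Q P + (ln (2 / delta))%:E + (1 / 2)%:E)
       + (Ymax * Num.sqrt (ln (2 / delta) / (2 * n%:R)))%:E)%E ].
Proof.
move=> P.
(* [X] is nonempty, since otherwise [D] would have total mass 0; any point of it bounds [M] from
   below by a norm. *)
have M_ge0 : 0 <= M.
  have [[x Xx]|X0] := pselect (X !=set0).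
    by rewrite (le_trans _ (X_bounded _ Xx))// sqrtr_ge0.
  have /eqP : D setT = 0%E.
    apply: D_on_X => //; apply/seteqP; split => // -[x y] [_ [Xx _]].
    by apply: X0; exists x.
  by rewrite probability_setT onee_eq0.
(* [X] may fail to be measurable; the ball [A] is measurable and contains it in the first
   coordinate, so its complement is null. *)
pose A := [set p : euclid R d * measurableTypeR R | enorm p.1 <= M].
have mA : measurable A.
  rewrite -[A]setTI; apply: measurable_fun_le => //.
  exact: (measurableT_comp measurable_enorm).
have DA0 : D (~` A) = 0%E.
  apply: D_on_X; first exact: measurableC.
  apply/seteqP; split => // -[x y] /= [nA [Xx _]]; apply: nA; exact: X_bounded.
have xA : {ae D, forall p, enorm p.1 <= M}.
  by apply/negligibleP => //; exact: measurableC.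
(* The reference loss is that of the zero predictor, [|y|]. *)
pose ell0 (p : euclid R d * measurableTypeR R) : R := `|p.2|.
pose ell (w : euclid R d) (p : euclid R d * measurableTypeR R) : R :=
  `|dotp w p.1 - p.2|.
have mell0 : measurable_fun setT ell0 by exact: measurableT_comp.
have mell : measurable_fun setT
    (fun q : euclid R d * (euclid R d * measurableTypeR R) => ell q.1 q.2).
  apply: measurableT_comp => //; apply: measurable_funB.
    by apply: measurable_dotp => //; exact: measurableT_comp.
  exact: measurableT_comp.
have ell_close w : {ae D, forall p, `|ell w p - ell0 p| <= M * enorm w}.
  apply: filterS xA => p pM.
  (* Reverse triangle inequality, then Cauchy-Schwarz. *)
  rewrite /ell /ell0 -[X in `|_ - X|]normrN (le_trans (ler_dist_dist _ _))//.
  rewrite opprK subrK (le_trans (dotp_cauchy_schwarz _ _))// mulrC.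
  by rewrite ler_wpM2r// sqrtr_ge0.
have y_bd : {ae D, forall p, ell0 p <= Ymax} := y_bounded.
have ell0_int : D.-integrable setT (EFin \o ell0).
  have ell0_bounded : {ae D, forall p, `|ell0 p| <= Ymax}.
    by apply: filterS y_bd => p; rewrite normr_id.
  exact: ae_bounded_integrable mell0 ell0_bounded.
have delta2 : 0 < delta / 2 by rewrite divr_gt0.
have delta2V : (delta / 2)^-1 = 2 / delta by rewrite invf_div.
set L0 := \int[D]_p ell0 p.
pose LS0 (S : n.-tuple (euclid R d * measurableTypeR R)) :=
  n%:R^-1 * \sum_(i < n) ell0 (tnth S i).
have ell0_mean : holds_with_prob_ge (prob_power D n) (1 - delta / 2)
    [set S | L0 <= LS0 S + Ymax * Num.sqrt (ln (2 / delta) / (2 * n%:R))].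
  have := hoeffding_sample_mean _ _ _ D n ell0 0 Ymax (delta / 2) n_gt0 mell0.
  rewrite subr0 delta2V; apply => //.
    by apply: filterS y_bd => p; rewrite normr_ge0.
  by rewrite ltr_pdivrMr// mul1r (le_lt_trans delta_le1)// ltr1n.
have -> : 1 - delta = 1 - (delta / 2 + delta / 2) by congr (_ - _); field.
(* [M = 0] would put a zero in the denominator of [lam]; here both risks collapse to those of
   [ell0]. *)
have [M0|M_neq0] := eqVneq M 0.
  have x_null : holds_with_prob_ge (prob_power D n) (1 - delta / 2)
      [set S | forall i, A (tnth S i)].
    apply: holds_with_prob_ge_mono (prob_power_forall_ae _ _ _ D n A mA DA0) => //.
    by rewrite gerBl ltW.
  apply: holds_with_prob_ge_mono
    (holds_with_prob_geI _ _ _ _ _ _ _ _ x_null ell0_mean) => //.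
  move=> S [SA meanS] Q.
  have dotp0 w x : enorm x <= M -> dotp w x = 0.
    move=> xM; apply/eqP; rewrite -normr_le0 (le_trans (dotp_cauchy_schwarz _ _))//.
    by rewrite -[leRHS](mulr0 (enorm w)) ler_wpM2l ?sqrtr_ge0// (le_trans xM) ?M0.
  have -> : (\int[Q]_w risk absolute_loss D (linear_predictor w) = L0%:E)%E.
    rewrite -(probability_integral_cst _ _ _ Q L0); apply: eq_integral => w _.
    rewrite /L0 /Rintegral fineK; last first.
      exact: (integrable_fin_num measurableT ell0_int).
    apply: ae_eq_integral => //.
    - apply/measurable_EFinP.
      exact: (measurableT_comp mell (measurable_pair1 w)).
    - exact/measurable_EFinP.
    apply: filterS xA => p pM _.
    by rewrite /absolute_loss /linear_predictor dotp0// sub0r normrN.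
  have -> : (\int[Q]_w (empirical_risk absolute_loss S (linear_predictor w))%:E
      = (LS0 S)%:E)%E.
    rewrite -(probability_integral_cst _ _ _ Q (LS0 S)); apply: eq_integral => w _.
    congr (_ * _)%:E; apply: eq_bigr => i _.
    by rewrite /absolute_loss /linear_predictor dotp0 ?sub0r ?normrN//; exact: SA.
  (* The convention [0 * +oo = 0] removes the divergence term even when it is infinite. *)
  by rewrite M0 !mul0r mul0e adde0 -EFinD lee_fin.
have M_gt0 : 0 < M by rewrite lt_neqAle eq_sym M_neq0.
have sn0 : 0 < Num.sqrt n%:R :> R by rewrite sqrtr_gt0 ltr0n.
have sd0 : 0 < Num.sqrt d.+1%:R :> R by rewrite sqrtr_gt0 ltr0n.
(* The inverse of [lam] is the coefficient of the bracket in the conclusion. *)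
pose lam := Num.sqrt n%:R / (M * sigma * Num.sqrt d.+1%:R).
have lam_gt0 : 0 < lam by rewrite divr_gt0// !mulr_gt0.
have mB : measurable_fun setT (fun w : euclid R d => M * enorm w).
  by apply: measurable_funM => //; exact: measurable_enorm.
have exp_moment : (\int[P]_w (expR ((lam * (2 * (M * enorm w))) ^+ 2 / (8 * n%:R)))%:E
    <= (expR (1 / 2))%:E)%E.
  apply: le_trans (isotropic_normal_sqr_mgf_le _ d _ sigma_gt0).
  rewrite le_eqVlt; apply/orP; left; apply/eqP; apply: eq_integral => w _.
  congr (expR _)%:E; rewrite -enorm_sqr !exprMn exprVn !exprMn !sqr_sqrtr ?ler0n//.
    by field; rewrite nat1r !pnatr_eq0 !gt_eqF//= -lt0n n_gt0.
  exact: dotp_ge0.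
have delta2_le1 : delta / 2 <= 1.
  by rewrite ler_pdivrMr// mul1r (le_trans delta_le1)// ler1n.
have half_ge0 : 0 <= 1 / 2 :> R by rewrite divr_ge0.
have gap := pac_bayes_bounded_gap _ _ _ _ R D P n ell ell0 (fun w => M * enorm w)
  lam (1 / 2) (delta / 2) n_gt0 mell mell0 mB
  (fun _ _ => normr_ge0 _) (fun _ => normr_ge0 _)
  ell0_int ell_close lam_gt0 half_ge0 delta2 delta2_le1 exp_moment.
apply: holds_with_prob_ge_mono (holds_with_prob_geI _ _ _ _ _ _ _ _ gap ell0_mean) => //.
move=> S [gapS meanS] Q.
have /= := gapS Q; rewrite -/(LS0 S) -/L0 delta2V /lam invf_div => le_gap.
(* Adding the finite [LS0 S] to both sides matches the left side of [le_gap]; [meanS] then replaces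
   [L0]. *)
rewrite -(leeD2rE _ _ (erefl : (LS0 S)%:E \is a fin_num)).
apply: le_trans le_gap _.
rewrite -[(_ + (ln _)%:E + _)%E]addeA -EFinD.
rewrite addeAC -[leRHS]addeA leeD2l// -EFinD lee_fin.
by rewrite addrC.
Qed.
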